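(* Let $r$ be a random variable such that $\mathbb{P}(r\geq -1)=1$, $\mathbb{P}(r>0)>0$, $\mathbb{P}(r<0)>0$, and $\mathbb{E}|\ln(1+r)|<\infty$, and let $g_r(f)=\mathbb{E}\ln(1+fr)$. If $$\lim_{f\to 0+}\mathbb{E}\left[\frac{r}{1+fr}\right]>0\qquad\text{and}\qquad \lim_{f\to 1-}\mathbb{E}\left[\frac{r}{1+fr}\right]<0,$$ then there is a unique $f^*\in(0,1)$ such that $$g_r(f)<g_r(f^* )$$ for all $f\neq f^*$ in the domain of $g_r$.
   Context: The domain of $g_r$ is the set of real numbers $f$ for which $g_r(f)$ is defined, that is, $\mathbb{P}(1+fr>0)=1$ and $\mathbb{E}|\ln(1+fr)|<\infty$; it contains $[0,1]$ and may be larger. The two limits are understood in the extended real line (the first may equal $+\infty$, the second $-\infty$). *)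

(* Defs.v *)
From HB Require Import structures.
From mathcomp Require Import all_boot all_order all_algebra.
From mathcomp Require Import all_classical all_reals all_analysis.

Set Implicit Arguments.
Unset Strict Implicit.
Unset Printing Implicit Defensive.

Import Order.TTheory GRing.Theory Num.Theory.
Import numFieldNormedType.Exports.

Local Open Scope classical_set_scope.
Local Open Scope ring_scope.
Local Open Scope ereal_scope.

(* The logarithm is the extended one, [lne]: it takes the value -oo at 0,
   whereas [ln 0 = 0]. With [ln], the condition E|ln(1 + r)| < +oo would not
   exclude an atom of r at -1. *)

Definition abs_log_mean (d : measure_display) (T : measurableType d)
    (R : realType) (P : probability T R) (r : T -> R) (f : R) : \bar R :=
  \int[P]_x `| lne (1 + f * r x)%R%:E |.

Definition growth (d : measure_display) (T : measurableType d)
    (R : realType) (P : probability T R) (r : T -> R) (f : R) : \bar R :=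
  \int[P]_x lne (1 + f * r x)%R%:E.

Definition growth_domain (d : measure_display) (T : measurableType d)
    (R : realType) (P : probability T R) (r : T -> R) : set R :=
  [set f | P [set x | (0 < 1 + f * r x)%R] = 1 /\ abs_log_mean P r f < +oo].

Definition score (d : measure_display) (T : measurableType d)
    (R : realType) (P : probability T R) (r : T -> R) (f : R) : \bar R :=
  'E_P[(fun x => r x / (1 + f * r x))%R].

(* Main.v *)
Require Import Defs.
From HB Require Import structures.
From mathcomp Require Import all_boot all_order all_algebra.
From mathcomp Require Import all_classical all_reals all_analysis.
From mathcomp Require Import measurable_realfun ring lra.

Set Implicit Arguments.
Unset Strict Implicit.
Unset Printing Implicit Defensive.

Import Order.TTheory GRing.Theory Num.Theory.
Import numFieldNormedType.Exports.

Local Open Scope classical_set_scope.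
Local Open Scope ring_scope.
Local Open Scope ereal_scope.

(** The idea is to compare the logarithm with its tangent line. The score
    s(f) = E[r / (1 + f r)] is the formal derivative of the growth
    g(f) = E[ln (1 + f r)], but g itself is never differentiated.

    For f in [a, b], where 0 < a and b < 1, the ratio r / (1 + f r) is bounded
    almost surely by C = 1/a + 1/(1 - b) ([ratio_bound]). Hence s is finite on
    (0, 1), and the identity [ratioB] shows that s is nonincreasing there
    ([score_nonincreasing]) and Lipschitz on [a, b] with constant C^2
    ([score_lipschitz]). Monotonicity turns the two limits into a supremum and
    an infimum over (0, 1), so that s takes a positive and a negative value;
    the intermediate value theorem then gives m in (0, 1) with s(m) = 0
    ([score_root]).

    For any f in the domain, concavity of the logarithm gives almost surely
      ln (1 + f r) <= ln (1 + m r) + (f - m) r / (1 + m r),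
    with equality only if f = m or r = 0. The right-hand side has mean
    g(m) + (f - m) s(m) = g(m), and r is nonzero with positive
    probability, so g(f) < g(m) for f different from m
    ([growth_lt_of_score_eq0]). This needs g(m) to be finite, which follows
    from |ln (1 + m r)| <= |ln (1 + r)| + |ln (1 - m)| ([abs_ln_le]). Two
    distinct maximizers in (0, 1), both in the domain, would each have strictly
    larger growth than the other. *)

(** * Measurability *)

Lemma measurable_invr (R : realType) :
  measurable_fun [set: R] (fun y : R => y^-1)%R.
Proof.
(* y^-1 = y * (y^2)^-1, also at y = 0, and the power function with exponent -1
   is the inverse on nonnegative reals. *)
rewrite (_ : (fun y => _) = fun y : R => (y * (y ^+ 2) `^ (-1))%R); last first.
  apply/funext => y; rewrite powR_inv1 ?sqr_ge0//.
  have [->|y0] := eqVneq y 0%R; first by rewrite mul0r invr0.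
  by rewrite expr2 invfM mulrA divff// mul1r.
apply: measurable_funM => //.
apply: (measurableT_comp (measurable_powR _)).
exact: measurable_funX.
Qed.

Section measurable_upper_level.
Context d (T : measurableType d) (R : realType) (u : T -> R) (c : R)
  (mu : measurable_fun setT u).

Lemma measurable_set_lt : measurable [set x | (c < u x)%R].
Proof.
rewrite (_ : mkset _ = setT `&` u @^-1` `]c, +oo[%classic).
  by apply: mu => //; exact: measurable_itv.
by apply/seteqP; split => x /=; rewrite in_itv/= andbT// => -[].
Qed.

Lemma measurable_set_le : measurable [set x | (c <= u x)%R].
Proof.
rewrite (_ : mkset _ = setT `&` u @^-1` `[c, +oo[%classic).
  by apply: mu => //; exact: measurable_itv.
by apply/seteqP; split => x /=; rewrite in_itv/= andbT// => -[].
Qed.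

End measurable_upper_level.

(** * Integrals of functions compared almost everywhere *)

Section almost_everywhere_integral.
Context d (T : measurableType d) (R : realType) (mu : {measure set T -> \bar R}).
Implicit Types u v h : T -> R.

Lemma integral_ae_ge0 h : measurable_fun setT h ->
  {ae mu, forall x, (0 <= h x)%R} ->
  \int[mu]_x (h x)%:E = \int[mu]_x `|(h x)%:E|.
Proof.
move=> mh h0; apply: ae_eq_integral => //.
- exact/measurable_EFinP.
- by apply: measurableT_comp => //; exact/measurable_EFinP.
- by apply: filterS h0 => x hx _; rewrite gee0_abs// lee_fin.
Qed.

Lemma le_integral_ae u v :
  mu.-integrable setT (EFin \o u) -> mu.-integrable setT (EFin \o v) ->
  {ae mu, forall x, (u x <= v x)%R} ->
  \int[mu]_x (u x)%:E <= \int[mu]_x (v x)%:E.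
Proof.
move=> iu iv uv.
have mu' : measurable_fun setT u by apply/measurable_EFinP; case/integrableP: iu.
have mv' : measurable_fun setT v by apply/measurable_EFinP; case/integrableP: iv.
rewrite -sube_ge0; last by rewrite integrable_fin_num.
rewrite -integralB_EFin//.
under eq_integral do rewrite -EFinB.
rewrite (@integral_ae_ge0 (fun x => v x - u x)%R).
- exact: integral_ge0.
- exact: measurable_funB.
- by apply: filterS uv => x; rewrite subr_ge0.
Qed.

(** The equality case of the monotonicity of the integral. *)
Lemma ae_eq_integral_ge u v :
  mu.-integrable setT (EFin \o u) -> mu.-integrable setT (EFin \o v) ->
  {ae mu, forall x, (u x <= v x)%R} ->
  \int[mu]_x (v x)%:E <= \int[mu]_x (u x)%:E ->
  {ae mu, forall x, u x = v x}.
Proof.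
move=> iu iv uv vu.
have mu' : measurable_fun setT u by apply/measurable_EFinP; case/integrableP: iu.
have mv' : measurable_fun setT v by apply/measurable_EFinP; case/integrableP: iv.
have mvu : measurable_fun setT (fun x => v x - u x)%R by exact: measurable_funB.
have : \int[mu]_x `|(v x - u x)%:E| = 0.
  rewrite -(@integral_ae_ge0 (fun x => v x - u x)%R)//; last first.
    by apply: filterS uv => x; rewrite subr_ge0.
  under eq_integral do rewrite EFinB.
  rewrite integralB_EFin//; apply/eqP; rewrite sube_eq//.
  - by rewrite add0e eq_le vu le_integral_ae.
  - exact: (integrable_fin_num measurableT iv).
have mvu' : measurable_fun setT (EFin \o (fun x => v x - u x)%R).
  exact/measurable_EFinP.
move/(ae_eq_integral_abs mu measurableT mvu'); apply: filterS => x /(_ I)/=.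
by case=> /eqP; rewrite subr_eq0 => /eqP.
Qed.

End almost_everywhere_integral.

Section almost_sure.
Context d (T : measurableType d) (R : realType) (P : probability T R).

Lemma ae_of_probability1 (A : set T) :
  measurable A -> P A = 1 -> {ae P, forall x, A x}.
Proof.
move=> mA PA; exists (~` A); split => //; first exact: measurableC.
by rewrite probability_setC// PA subee.
Qed.

Lemma ae_notin_measure0 (A : set T) :
  measurable A -> {ae P, forall x, ~ A x} -> P A = 0.
Proof.
move=> mA [N [mN PN AN]]; apply/eqP; rewrite -measure_le0 -PN.
by rewrite le_measure ?inE// => x Ax; apply: AN => /=; exact.
Qed.

Lemma integrable_ae_bounded (h : T -> R) (M : R) : (0 <= M)%R ->
  measurable_fun setT h -> {ae P, forall x, (`|h x| <= M)%R} ->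
  P.-integrable setT (EFin \o h) /\ `|\int[P]_x (h x)%:E| <= M%:E.
Proof.
move=> M0 mh hM.
have mh' : measurable_fun setT (EFin \o h) by exact/measurable_EFinP.
have H : \int[P]_x `|(EFin \o h) x| <= M%:E.
  rewrite -[leRHS]mule1 -(probability_setT P).
  apply: integral_le_bound => //.
  by apply: filterS hM => x hx _; rewrite lee_fin.
split; first by apply/integrableP; split => //; rewrite (le_lt_trans H)// ltry.
exact: le_trans (le_abse_integral _ _ _) H.
Qed.

End almost_sure.

(** * Inequalities between real numbers *)

Section real_inequalities.
Context {R : realType}.
Implicit Types a b f g t y z : R.
Local Open Scope ring_scope.

Lemma ln_le_tangent y z : 0 < y -> 0 < z -> ln z <= ln y + (z - y) / y.
Proof.
move=> y0 z0; have zy : 0 < z / y by rewrite divr_gt0.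
have := @le_ln1Dx R (z / y - 1).
rewrite ltrBrDl subrr => /(_ zy); rewrite addrC subrK ln_div// mulrBl divff ?gt_eqF//.
by rewrite lerBlDl.
Qed.

Lemma ln_eq_tangent y z : 0 < y -> 0 < z -> ln z = ln y + (z - y) / y -> z = y.
Proof.
move=> y0 z0 H; have zy : 0 < z / y by rewrite divr_gt0.
have [|/expR_gt1Dx] := eqVneq (ln (z / y)) 0.
  by move/eqP; rewrite ln_eq0// => /eqP/divr1_eq.
rewrite lnK// ln_div// H addrAC subrr add0r mulrBl divff ?gt_eqF//.
by rewrite addrC subrK ltxx.
Qed.

Lemma den_gt0 f t : 0 < f < 1 -> -1 <= t -> 0 < 1 + f * t.
Proof. by move=> /andP[f0 f1] t1; nra. Qed.

(** The bound 1/f is used for t >= 0 and the bound 1/(1 - f) for t < 0. *)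
Lemma ratio_bound a b f t : 0 < a -> b < 1 -> a <= f <= b -> -1 <= t ->
  `|t / (1 + f * t)| <= a^-1 + (1 - b)^-1.
Proof.
move=> a0 b1 /andP[af fb] t1.
have b'0 : 0 < 1 - b by rewrite subr_gt0.
have y0 : 0 < 1 + f * t by apply: den_gt0 => //; lra.
rewrite normrM normfV (gtr0_norm y0) ler_pdivrMr//.
have [t0|t0] := ger0P t.
  apply: (@le_trans _ _ (a^-1 * (1 + f * t))).
    by rewrite ler_pdivlMl//; nra.
  by rewrite ler_wpM2r ?(ltW y0)// lerDl invr_ge0 ltW.
apply: (@le_trans _ _ ((1 - b)^-1 * (1 + f * t))).
  by rewrite ler_pdivlMl//; nra.
by rewrite ler_wpM2r ?(ltW y0)// lerDr invr_ge0 ltW.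
Qed.

Lemma ratioB f g t : 1 + f * t != 0 -> 1 + g * t != 0 ->
  t / (1 + f * t) - t / (1 + g * t) =
  (g - f) * ((t / (1 + f * t)) * (t / (1 + g * t))).
Proof. by move=> ? ?; field; apply/andP. Qed.

(** For t >= 0, 1 + f t lies between 1 and 1 + t; for t < 0 it lies between
    1 - f and 1. At t = -1 the convention ln 0 = 0 is harmless, since only the
    second summand is used when t < 0. *)
Lemma abs_ln_le f t : 0 < f < 1 -> -1 <= t ->
  `|ln (1 + f * t)| <= `|ln (1 + t)| + `|ln (1 - f)|.
Proof.
move=> f01 t1; have y0 := den_gt0 f01 t1; move: (f01) => /andP[f0 f1].
have [t0|t0] := leP 0 t.
  have ft : 1 <= 1 + f * t by rewrite lerDl mulr_ge0// ltW.
  have lef : 1 + f * t <= 1 + t by rewrite lerD2l ler_piMl// ltW.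
  rewrite ger0_norm ?ln_ge0//; apply: (@le_trans _ _ (ln (1 + t))).
    by rewrite ler_ln ?posrE// (lt_le_trans y0).
  by rewrite (le_trans (ler_norm _))// lerDl.
have ft : 1 + f * t <= 1 by rewrite gerDl pmulr_rle0// ltW.
have f'0 : 0 < 1 - f by rewrite subr_gt0.
have lef : 1 - f <= 1 + f * t by nra.
rewrite ler0_norm ?ln_le0//; apply: (@le_trans _ _ (- ln (1 - f))).
  by rewrite lerN2 ler_ln ?posrE.
by rewrite (le_trans (ler_norm _))// normrN lerDr.
Qed.

End real_inequalities.

Section extended_logarithm.
Context {R : realType}.

Lemma measurable_lne : measurable_fun [set: R] (fun y : R => lne y%:E).
Proof.
apply: measurable_fun_ifT => //; first exact: measurable_fun_ler.
by apply/measurable_EFinP; exact: measurable_ln.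
Qed.

(** For y <= 0 the left-hand side is 0 and the right-hand side is +oo. *)
Lemma abse_ln_le_lne (y : R) : `|(ln y)%:E| <= `|lne y%:E|.
Proof.
have [y0|y0] := leP y 0%R; last by rewrite lne_EFin.
by rewrite le0_lneNy ?lee_fin//= leey.
Qed.

End extended_logarithm.

(** * The score and its zero *)

Section score_growth.
Context d (T : measurableType d) (R : realType) (P : probability T R)
  (r : T -> R) (mr : measurable_fun setT r)
  (r_ge : {ae P, forall x, (-1 <= r x)%R}).
Local Notation ratio f := (fun x => r x / (1 + f * r x))%R.

Lemma measurable_den f : measurable_fun setT (fun x => 1 + f * r x)%R.
Proof. by apply: measurable_funD => //; exact: measurable_funM. Qed.

Lemma measurable_ratio f : measurable_fun setT (ratio f).
Proof.
apply: measurable_funM => //.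
exact: (measurableT_comp (@measurable_invr R) (measurable_den f)).
Qed.

Lemma measurable_log f : measurable_fun setT (fun x => ln (1 + f * r x))%R.
Proof. exact: (measurableT_comp (@measurable_ln R) (measurable_den f)). Qed.

Lemma measurable_elog f :
  measurable_fun setT (fun x => lne (1 + f * r x)%R%:E).
Proof. exact: (measurableT_comp measurable_lne (measurable_den f)). Qed.

Lemma ae_den_gt0 f : (0 < f < 1)%R -> {ae P, forall x, (0 < 1 + f * r x)%R}.
Proof. by move=> f01; apply: filterS r_ge => x; exact: den_gt0. Qed.

Lemma integrable_ratio f : (0 < f < 1)%R ->
  P.-integrable setT (EFin \o ratio f).
Proof.
move=> /andP[f0 f1].
have [] // := @integrable_ae_bounded _ _ _ P (ratio f) (f^-1 + (1 - f)^-1)%R.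
- by rewrite addr_ge0// invr_ge0 ?subr_ge0 ltW.
- exact: measurable_ratio.
- by apply: filterS r_ge => x; apply: ratio_bound => //; rewrite lexx.
Qed.

Lemma scoreE f : score P r f = \int[P]_x (ratio f x)%:E.
Proof. by rewrite /score expectation.unlock. Qed.

Lemma score_fin_num f : (0 < f < 1)%R -> score P r f \is a fin_num.
Proof.
move=> f01; rewrite scoreE.
exact: (integrable_fin_num measurableT (integrable_ratio f01)).
Qed.

Lemma score_nonincreasing f g : (0 < f)%R -> (f <= g)%R -> (g < 1)%R ->
  score P r g <= score P r f.
Proof.
move=> f0 fg g1.
have f01 : (0 < f < 1)%R by rewrite f0 (le_lt_trans fg).
have g01 : (0 < g < 1)%R by rewrite g1 (lt_le_trans f0).
rewrite !scoreE; apply: le_integral_ae; try exact: integrable_ratio.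
apply: filterS r_ge => x rx; have yf := den_gt0 f01 rx; have yg := den_gt0 g01 rx.
rewrite -subr_ge0 ratioB ?gt_eqF//; apply: mulr_ge0; first by rewrite subr_ge0.
by rewrite mulrACA -expr2 mulr_ge0 ?sqr_ge0// mulr_ge0// invr_ge0 ltW.
Qed.

Lemma score_lipschitz a b f g : (0 < a)%R -> (b < 1)%R ->
    (a <= f <= b)%R -> (a <= g <= b)%R ->
  (`|fine (score P r f) - fine (score P r g)|
   <= (a^-1 + (1 - b)^-1) ^+ 2 * `|f - g|)%R.
Proof.
move=> a0 b1 fab gab.
have f01 : (0 < f < 1)%R by lra.
have g01 : (0 < g < 1)%R by lra.
have M0 : (0 <= a^-1 + (1 - b)^-1 :> R)%R.
  by rewrite addr_ge0// invr_ge0 ?subr_ge0 ltW.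
rewrite -lee_fin -abse_EFin EFinB !fineK ?score_fin_num// !scoreE.
rewrite -integralB_EFin//; try exact: integrable_ratio.
under eq_integral do rewrite -EFinB.
apply: (proj2 (@integrable_ae_bounded _ _ _ P
  (fun x => ratio f x - ratio g x)%R _ _ _ _)).
- by rewrite mulr_ge0// sqr_ge0.
- by apply: measurable_funB; exact: measurable_ratio.
apply: filterS r_ge => x rx; have yf := den_gt0 f01 rx; have yg := den_gt0 g01 rx.
rewrite ratioB ?gt_eqF// normrM distrC mulrC ler_wpM2r// normrM expr2.
by rewrite ler_pM// (@ratio_bound _ a b).
Qed.

Lemma score_root a b : (0 < a < 1)%R -> (0 < b < 1)%R ->
  0 < score P r a -> score P r b < 0 ->
  exists2 f : R, (0 < f < 1)%R & score P r f = 0.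
Proof.
move=> a01 b01 sa sb.
have ab : (a <= b)%R.
  rewrite leNgt; apply/negP => ba; have := lt_trans sb sa.
  by rewrite ltNge score_nonincreasing//; lra.
have cs : {within `[a, b], continuous (fine \o score P r)}.
  apply/subspace_continuousP => x /= xab; apply/cvgrPdist_le => e e0.
  (* K is a Lipschitz constant on [a, b]; K + 1 serves as a divisor because it
     is positive as soon as K is nonnegative. *)
  set K := ((a^-1 + (1 - b)^-1) ^+ 2)%R.
  have K0 : (0 < K + 1)%R by rewrite ltr_wpDl// sqr_ge0.
  have d0 : (0 < e / (K + 1))%R by rewrite divr_gt0.
  have near_x : \forall y \near x, (`|x - y| <= e / (K + 1))%R.
    exact: (@cvgr_dist_le _ _ _ (nbhs x) _ id).
  apply: filterS near_x => y xy yab /=.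
  apply: (@le_trans _ _ (K * `|x - y|)%R).
    by move: xab yab; rewrite !in_itv /=; apply: score_lipschitz; lra.
  apply: (@le_trans _ _ ((K + 1) * `|x - y|)%R).
    by rewrite ler_wpM2r// lerDl.
  by rewrite mulrC -ler_pdivlMr.
have [|c] := @IVT R (fine \o score P r) a b 0%R ab cs.
  rewrite /= ge_min le_max -!lee_fin !fineK ?score_fin_num//.
  by rewrite (ltW sb) (ltW sa) orbT.
rewrite in_itv/= => /andP[ac cb] c0.
have c01 : (0 < c < 1)%R by lra.
exists c => //; rewrite -(fineK (score_fin_num c01)).
by move: c0 => /= ->.
Qed.

Lemma score_gt0_of_lim : 0 < lim (score P r f @[f --> (0 : R)%R^'+]) ->
  exists2 f : R, (0 < f < 1)%R & 0 < score P r f.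
Proof.
have H : score P r f @[f --> (0 : R)%R^'+] -->
    ereal_sup (score P r @` [set` `]0%R, 1%R[]).
  apply: (@nonincreasing_at_right_cvge _ _ _ (BLeft 1%R)).
    by rewrite bnd_simp.
  move=> f g; rewrite !in_itv/= => /andP[f0 f1] /andP[g0 g1] fg.
  exact: score_nonincreasing.
rewrite (cvg_lim _ H)// => /ereal_sup_gt[_ [f/= + <-] sf].
by rewrite in_itv/= => f01; exists f.
Qed.

Lemma score_lt0_of_lim : lim (score P r f @[f --> (1 : R)%R^'-]) < 0 ->
  exists2 f : R, (0 < f < 1)%R & score P r f < 0.
Proof.
have H : score P r f @[f --> (1 : R)%R^'-] -->
    ereal_inf ((score P r \o -%R) @` [set` `](-1)%R, 0%R[]).
  (* The change of variable f := - f turns the left limit at 1 into a right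
     limit at -1. *)
  apply/cvg_at_leftNP.
  apply: (@nondecreasing_at_right_cvge _ _ _ (BLeft 0%R)).
    by rewrite bnd_simp ltrN10.
  move=> f g; rewrite !in_itv/= => /andP[f0 f1] /andP[g0 g1] fg.
  by apply: score_nonincreasing; lra.
rewrite (cvg_lim _ H)// => /ereal_inf_lt[_ [f/= + <-] sf].
by rewrite in_itv/= => f01; exists (- f)%R => //; lra.
Qed.

(** * The growth and its maximum *)

(** On the domain, the extended logarithm can be replaced with the real one. *)
Lemma growth_domainP f : growth_domain P r f ->
  [/\ {ae P, forall x, (0 < 1 + f * r x)%R},
      P.-integrable setT (EFin \o (fun x => ln (1 + f * r x))%R) &
      growth P r f = \int[P]_x (ln (1 + f * r x))%:E].
Proof.
move=> [P1 Iab].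
have pos : {ae P, forall x, (0 < 1 + f * r x)%R}.
  by apply: ae_of_probability1 P1; exact/measurable_set_lt/measurable_den.
have ml : measurable_fun setT (EFin \o (fun x => ln (1 + f * r x))%R).
  by apply/measurable_EFinP; exact: measurable_log.
split => //.
- apply/integrableP; split => //; apply: le_lt_trans Iab.
  apply: ge0_le_integral => //.
  + exact: measurableT_comp.
  + by apply: measurableT_comp => //; exact: measurable_elog.
  + by move=> x _; exact: abse_ln_le_lne.
- apply: ae_eq_integral => //; first exact: measurable_elog.
  by apply: filterS pos => x x0 _; exact: lne_EFin.
Qed.

Lemma growth_domain01 f : \int[P]_x `| lne (1 + r x)%R%:E | < +oo ->
  (0 < f < 1)%R -> growth_domain P r f.
Proof.
move=> r_log f01; have pos := ae_den_gt0 f01.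
have mpos : measurable [set x | (0 < 1 + f * r x)%R].
  exact/measurable_set_lt/measurable_den.
have ml g : measurable_fun setT (EFin \o (fun x => ln (1 + g * r x))%R).
  by apply/measurable_EFinP; exact: measurable_log.
split.
  rewrite -[X in P X]setCK probability_setC; last exact: measurableC.
  rewrite ae_notin_measure0 ?sube0//; first exact: measurableC.
  by apply: filterS pos => x x0; apply.
(* The integrand of the domain condition is dominated by |ln (1 + r)| plus a
   constant. *)
have i1 : P.-integrable setT (EFin \o (fun x => ln (1 + 1 * r x))%R).
  apply/integrableP; split => //; apply: le_lt_trans r_log.
  apply: ge0_le_integral => //; first exact: measurableT_comp.
    apply: measurableT_comp => //; apply: (measurableT_comp measurable_lne).
    exact: measurable_funD.
  by move=> x _ /=; rewrite mul1r; exact: abse_ln_le_lne.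
have i2 := finite_measure_integrable_cst P `|ln (1 - f)|%R measurableT.
have /integrableP[_] := integrableD measurableT (integrable_abse i1) i2.
apply: le_lt_trans; apply: ae_ge0_le_integral => //.
- by apply: measurableT_comp => //; exact: measurable_elog.
- apply: measurableT_comp => //; apply: emeasurable_funD => //.
    exact: measurableT_comp.
  by apply/measurable_EFinP; exact: measurable_cst.
apply: filterS (filterI pos r_ge) => x [x0 rx] _; rewrite lne_EFin//= lee_fin mul1r.
by rewrite (le_trans (abs_ln_le f01 rx))// ler_norm.
Qed.

(** A zero of the score is a strict maximizer of the growth, by the tangent line
    inequality for the logarithm. *)
Lemma growth_lt_of_score_eq0 f g : (0 < f < 1)%R ->
  growth_domain P r f -> score P r f = 0 -> ~ {ae P, forall x, r x = 0%R} ->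
  growth_domain P r g -> g <> f -> growth P r g < growth P r f.
Proof.
move=> f01 domf sf0 r_neq0 domg gf.
have [posf ilf growthf] := growth_domainP domf.
have [posg ilg growthg] := growth_domainP domg.
have irf := integrable_ratio f01.
pose w x := (ln (1 + f * r x) + (g - f) * (r x / (1 + f * r x)))%R.
have iw : P.-integrable setT (EFin \o w) :=
  integrableD measurableT ilf (integrableZl measurableT (g - f)%R irf).
have Ew : \int[P]_x (w x)%:E = growth P r f.
  under eq_integral do rewrite EFinD EFinM.
  rewrite integralD//; last exact: integrableZl.
  by rewrite integralZl// -(scoreE f) sf0 mule0 adde0.
(* w has the form required by the tangent line inequality. *)
have tangentE x : ((g - f) * (r x / (1 + f * r x)) =
    ((1 + g * r x) - (1 + f * r x)) / (1 + f * r x))%R by ring.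
rewrite -Ew growthg ltNge; apply/negP => le_w.
have le_lnw : {ae P, forall x, (ln (1 + g * r x) <= w x)%R}.
  apply: filterS (filterI posg posf) => x [z0 y0].
  by rewrite /w tangentE; exact: ln_le_tangent.
have eq_lnw := ae_eq_integral_ge ilg iw le_lnw le_w.
apply: r_neq0; apply: filterS (filterI eq_lnw (filterI posg posf)) => x.
move=> [+ [z0 y0]]; rewrite /w tangentE => /(ln_eq_tangent y0 z0)/addrI/eqP.
by rewrite -subr_eq0 -mulrBl mulf_eq0 subr_eq0 => /orP[/eqP//|/eqP].
Qed.

End score_growth.

Theorem proposition2p3 (d : measure_display) (T : measurableType d)
    (R : realType) (P : probability T R) (r : {RV P >-> R})
    (r_geN1 : P [set x | (-1 <= r x)%R] = 1)
    (r_gt0 : 0 < P [set x | (0 < r x)%R])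
    (r_lt0 : 0 < P [set x | (r x < 0)%R])
    (r_log : \int[P]_x `| lne (1 + r x)%R%:E | < +oo)
    (lim0 : 0 < lim (score P r f @[f --> (0 : R)%R^'+]))
    (lim1 : lim (score P r f @[f --> (1 : R)%R^'-]) < 0) :
  exists! fs : R, (0 < fs < 1)%R /\
    forall f : R, growth_domain P r f -> f <> fs ->
      growth P r f < growth P r fs.
Proof.
have mr : measurable_fun setT r by exact: measurable_funPT.
have r_ge : {ae P, forall x, (-1 <= r x)%R}.
  by apply: ae_of_probability1 r_geN1; exact: measurable_set_le.
have r_neq0 : ~ {ae P, forall x, r x = 0%R}.
  move=> r0; move: r_gt0; rewrite ae_notin_measure0 ?ltxx//.
    exact: measurable_set_lt.
  by apply: filterS r0 => x /= ->; rewrite ltxx.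
have [a a01 sa] := score_gt0_of_lim mr r_ge lim0.
have [b b01 sb] := score_lt0_of_lim mr r_ge lim1.
have [fs fs01 s0] := score_root mr r_ge a01 b01 sa sb.
have dom01 := growth_domain01 mr r_ge r_log.
have fs_max f : growth_domain P r f -> f <> fs -> growth P r f < growth P r fs.
  exact: (growth_lt_of_score_eq0 mr r_ge fs01 (dom01 _ fs01) s0 r_neq0).
exists fs; split => // fs' [fs'01 fs'_max]; apply: contrapT => neq.
have lt_fs' := fs'_max _ (dom01 _ fs01) neq.
have := fs_max _ (dom01 _ fs'01) (fun e => neq (esym e)).
by rewrite ltNge (ltW lt_fs').
Qed.
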